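(* Let $X\subset\mathbb{R}^s$ be an open set, let $C\subset\mathbb{R}^n$ and $K\subset\mathbb{R}^m$ be closed convex cones with vertex at the origin such that the positive polar cones $C^*$ and $K^*$ are pointed, and let $f:X\to\mathbb{R}^n$ and $g:X\to\mathbb{R}^m$ be Fréchet differentiable functions. Consider the problem (P): $C$-minimize $f(x)$ subject to $g(x)\in-K$. Then (P) is FJ-pseudoinvex if and only if every Fritz John vector critical point of (P) is a weak global minimizer of (P).
   Context: Notation: $a\cdot b$ is the scalar product in Euclidean space, $Jf(x)$ and $Jg(x)$ are Jacobian matrices, $\lambda\cdot Jf(x)=\lambda^{T}Jf(x)$, $\mathrm{int}$ is topological interior. For a cone $A$ in a Euclidean space, the positive polar cone is $A^*=\{\lambda\mid\lambda\cdot a\ge0\text{ for all }a\in A\}$, and $A^{**}=(A^* )^*$. A cone $A$ with vertex at the origin is pointed iff $A\cap(-A)=\{0\}$. A point $x\in X$ is feasible for (P) iff $g(x)\in -K$. For a feasible point $x$ put $M^*(x)=\{\mu\in K^*\mid\mu\cdot g(x)=0\}$, and let $M^{**}(x)$ be the positive polar cone of $M^*(x)$. A feasible point $x$ is a weak global minimizer (weakly efficient global solution) of (P) iff there is no other feasible point $y$ such that $f(y)\in f(x)-\mathrm{int}(C)$. A feasible point $x$ is a Fritz John (vector) critical point of (P) iff there exist $\lambda\in C^*$ and $\mu\in K^*$ with $(\lambda,\mu)\neq(0,0)$, $\lambda\cdot Jf(x)+\mu\cdot Jg(x)=0$ and $\mu\cdot g(x)=0$. Problem (P) is called FJ-pseudoinvex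 (Fritz John pseudoinvex) iff for all $x,y\in X$ there exists $\eta(x,y)\in\mathbb{R}^s$ such that the following implication holds: if $f(y)\in f(x)-\mathrm{int}(C)$, $g(x)\in-K$ and $g(y)\in-K$, then $Jf(x)\eta(x,y)\in-\mathrm{int}(C^{**})$ and $Jg(x)\eta(x,y)\in-\mathrm{int}(M^{**}(x))$.
   Formalization: In ''weak global minimizer'' the word ''other'' is dropped (y = x is allowed); this matters only for C = R^n, where the literal claim fails, e.g. X = R, f = 0, g(x) = x², K = [0,∞), C = R. *)

(* Defs.v *)
From HB Require Import structures.
From mathcomp Require Import all_boot all_order all_algebra.
From mathcomp Require Import all_classical all_reals all_analysis.

Set Implicit Arguments.
Unset Strict Implicit.
Unset Printing Implicit Defensive.

Import Order.TTheory GRing.Theory Num.Theory.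
Import numFieldNormedType.Exports.

Local Open Scope classical_set_scope.
Local Open Scope ring_scope.

Definition dotp (R : realType) (n : nat) (u v : 'rV[R]_n) : R :=
  \sum_(i < n) u 0 i * v 0 i.

(* The library's ['J f x] is the s x n matrix acting on row vectors on the
   right; the usual n x s matrix of partial derivatives is its transpose. *)
Definition Jac (R : realType) (s n : nat) (f : 'rV[R]_s -> 'rV[R]_n)
  (x : 'rV[R]_s) : 'M[R]_(n, s) := ('J f x)^T.

(* The product of the n x s matrix A with v in R^s, read as a column. *)
Definition mxapp (R : realType) (n s : nat) (A : 'M[R]_(n, s)) (v : 'rV[R]_s) :
  'rV[R]_n := (A *m v^T)^T.

Definition oppset (R : realType) (n : nat) (A : set 'rV[R]_n) : set 'rV[R]_n :=
  [set - a | a in A].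

Definition is_cone (R : realType) (n : nat) (A : set 'rV[R]_n) : Prop :=
  A 0 /\ forall (t : R) (a : 'rV[R]_n), 0 <= t -> A a -> A (t *: a).

Definition polar (R : realType) (n : nat) (A : set 'rV[R]_n) : set 'rV[R]_n :=
  [set l | forall a, A a -> 0 <= dotp l a].

Definition pointed (R : realType) (n : nat) (A : set 'rV[R]_n) : Prop :=
  A `&` oppset A = [set 0].

Definition feasible (R : realType) (s m : nat) (X : set 'rV[R]_s)
  (g : 'rV[R]_s -> 'rV[R]_m) (K : set 'rV[R]_m) (x : 'rV[R]_s) : Prop :=
  X x /\ oppset K (g x).

Definition Mstar (R : realType) (s m : nat) (g : 'rV[R]_s -> 'rV[R]_m)
  (K : set 'rV[R]_m) (x : 'rV[R]_s) : set 'rV[R]_m :=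
  [set mu | polar K mu /\ dotp mu (g x) = 0].

Definition strictly_better (R : realType) (s n : nat)
  (f : 'rV[R]_s -> 'rV[R]_n) (C : set 'rV[R]_n) (x y : 'rV[R]_s) : Prop :=
  [set f x - c | c in interior C] (f y).

(* The condition y != x is not imposed: it is automatic as soon as C is not the
   whole space (lemma [weak_global_minimizer_neq] below). When C is the whole
   space every point strictly improves on itself, in this definition as in that
   of FJ pseudoinvexity, where y = x is allowed. *)
Definition weak_global_minimizer (R : realType) (s n m : nat)
  (X : set 'rV[R]_s) (f : 'rV[R]_s -> 'rV[R]_n) (g : 'rV[R]_s -> 'rV[R]_m)
  (C : set 'rV[R]_n) (K : set 'rV[R]_m) (x : 'rV[R]_s) : Prop :=
  feasible X g K x /\
  ~ exists y, feasible X g K y /\ strictly_better f C x y.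

Definition FJ_critical (R : realType) (s n m : nat)
  (X : set 'rV[R]_s) (f : 'rV[R]_s -> 'rV[R]_n) (g : 'rV[R]_s -> 'rV[R]_m)
  (C : set 'rV[R]_n) (K : set 'rV[R]_m) (x : 'rV[R]_s) : Prop :=
  feasible X g K x /\
  exists (lambda : 'rV[R]_n) (mu : 'rV[R]_m),
    [/\ polar C lambda, polar K mu, (lambda, mu) <> (0, 0),
        lambda *m Jac f x + mu *m Jac g x = 0 & dotp mu (g x) = 0].

Definition FJ_pseudoinvex (R : realType) (s n m : nat)
  (X : set 'rV[R]_s) (f : 'rV[R]_s -> 'rV[R]_n) (g : 'rV[R]_s -> 'rV[R]_m)
  (C : set 'rV[R]_n) (K : set 'rV[R]_m) : Prop :=
  forall x y : 'rV[R]_s, X x -> X y ->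
  exists eta : 'rV[R]_s,
    strictly_better f C x y -> oppset K (g x) -> oppset K (g y) ->
    oppset (interior (polar (polar C))) (mxapp (Jac f x) eta) /\
    oppset (interior (polar (Mstar g K x))) (mxapp (Jac g x) eta).

Lemma cone_interior0 (R : realType) (n : nat) (C : set 'rV[R]_n) :
  is_cone C -> interior C 0 -> C = setT.
Proof.
move=> [_ Ct] /nbhs_ballP[e /= e0 eC]; apply/seteqP; split=> // v _.
have d0 : 0 < 1 + `|v| by rewrite ltr_pwDl.
pose t := e / (1 + `|v|).
have t0 : 0 < t by rewrite divr_gt0.
rewrite -(scale1r v) -(@mulVf _ t) ?gt_eqF// -scalerA.
apply: Ct; first by rewrite invr_ge0 ltW.
apply: eC; rewrite -ball_normE /= sub0r normrN normrZ gtr0_norm//.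
by rewrite /t mulrAC ltr_pdivrMr// ltr_pM2l// ltrDr.
Qed.

Lemma weak_global_minimizer_neq (R : realType) (s n m : nat)
  (X : set 'rV[R]_s) (f : 'rV[R]_s -> 'rV[R]_n) (g : 'rV[R]_s -> 'rV[R]_m)
  (C : set 'rV[R]_n) (K : set 'rV[R]_m) (x : 'rV[R]_s) :
  is_cone C -> C <> setT ->
  weak_global_minimizer X f g C K x <->
  feasible X g K x /\
  ~ exists y, [/\ y <> x, feasible X g K y & strictly_better f C x y].
Proof.
move=> Ccone CT; split=> -[Fx H]; split=> // -[y].
  by move=> [_ Fy xy]; apply: H; exists y.
move=> [Fy xy]; apply: H; exists y; split=> // yx; apply: CT.
apply: cone_interior0 => //; case: xy => c Cc; rewrite yx => E.
suff <- : c = 0 by [].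
by apply/eqP; rewrite -oppr_eq0 -(inj_eq (addrI (f x))) addr0 E.
Qed.

(* Main.v *)
Require Import Defs.
From HB Require Import structures.
From mathcomp Require Import all_boot all_order all_algebra.
From mathcomp Require Import all_classical all_reals all_analysis.
From mathcomp Require Import ring lra.

Import Order.TTheory GRing.Theory Num.Theory.
Import numFieldNormedType.Exports.

Local Open Scope classical_set_scope.
Local Open Scope ring_scope.

(** Both properties of (P) compare, at a feasible point [x], multipliers with
    directions, and the theorem reduces to a pointwise statement
    ([not_FJ_criticalP]): a feasible [x] is not Fritz John critical iff some
    [eta] satisfies [Jf(x) eta \in - int C**] and [Jg(x) eta \in - int M**(x)].
    Granting this, pseudoinvexity says that a feasible point that is strictly
    improved by another feasible point is not critical, which is the
    contrapositive of: critical points are weak global minimizers.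

    The interior of a polar is where strict inequalities live: [v] is interior to
    the polar of a closed cone [P] iff [l . v > 0] for all nonzero [l] in [P]
    ([interior_polarP]). So [eta] is a common strict solution of
    [l . Jf(x) eta < 0] and [u . Jg(x) eta < 0] over the nonzero [l] in [C*] and
    [u] in [M*(x)]. If such an [eta] exists, pairing [l Jf(x) + u Jg(x) = 0] with
    it gives a contradiction unless [l] and [u] vanish.

    The converse is a Gordan-type alternative. For feasible [x], [M*(x)] is itself
    a polar, that of [K] with [g(x)] adjoined ([polar_Mstar]), hence so is the
    product cone [C* x M*(x)] ([polar_block_union]), and it is pointed. For a
    matrix [T] that kills no nonzero element of a pointed polar,
    [pointed_polar_alternative] produces [eta] with [(w T) . eta > 0] for all its
    nonzero [w]. Pointedness first yields a vector [e] with [w . e > 0] for all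
    nonzero [w] of the polar ([pointed_polar_gt0]); then [eta] is [w0 T], where
    [w0] minimizes the quotient [|w T|^2 / (w . e)^2]. This amounts to taking the
    point closest to the origin in the image under [T] of the compact convex slice
    [w . e = 1], but the quotient is invariant under scaling, so that the minimum
    is attained by compactness of the unit sphere ([cone_min]), without any bound on
    the slice. *)

(** * The scalar product *)

Lemma dotpE {R : realType} {n : nat} (u v : 'rV[R]_n) :
  dotp u v = (u *m v^T) 0 0.
Proof. by rewrite mxE; apply: eq_bigr => i _; rewrite mxE. Qed.

Lemma dotpC {R : realType} {n : nat} (u v : 'rV[R]_n) : dotp u v = dotp v u.
Proof. by apply: eq_bigr => i _; rewrite mulrC. Qed.

Lemma dotpDl {R : realType} {n : nat} (u v w : 'rV[R]_n) :
  dotp (u + v) w = dotp u w + dotp v w.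
Proof. by rewrite !dotpE mulmxDl mxE. Qed.

Lemma dotpZl {R : realType} {n : nat} (t : R) (u v : 'rV[R]_n) :
  dotp (t *: u) v = t * dotp u v.
Proof. by rewrite !dotpE -scalemxAl mxE. Qed.

Lemma dotpNl {R : realType} {n : nat} (u v : 'rV[R]_n) :
  dotp (- u) v = - dotp u v.
Proof. by rewrite -scaleN1r dotpZl mulN1r. Qed.

Lemma dotp0l {R : realType} {n : nat} (v : 'rV[R]_n) : dotp 0 v = 0.
Proof. by rewrite dotpE mul0mx mxE. Qed.

Lemma dotpDr {R : realType} {n : nat} (u v w : 'rV[R]_n) :
  dotp u (v + w) = dotp u v + dotp u w.
Proof. by rewrite dotpC dotpDl !(dotpC _ u). Qed.

Lemma dotpZr {R : realType} {n : nat} (t : R) (u v : 'rV[R]_n) :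
  dotp u (t *: v) = t * dotp u v.
Proof. by rewrite dotpC dotpZl dotpC. Qed.

Lemma dotpNr {R : realType} {n : nat} (u v : 'rV[R]_n) :
  dotp u (- v) = - dotp u v.
Proof. by rewrite dotpC dotpNl dotpC. Qed.

Lemma dotp0r {R : realType} {n : nat} (u : 'rV[R]_n) : dotp u 0 = 0.
Proof. by rewrite dotpC dotp0l. Qed.

Lemma dotp_ge0 {R : realType} {n : nat} (u : 'rV[R]_n) : 0 <= dotp u u.
Proof. by apply: sumr_ge0 => i _; rewrite -expr2 sqr_ge0. Qed.

Lemma dotp_gt0 {R : realType} {n : nat} (u : 'rV[R]_n) :
  u != 0 -> 0 < dotp u u.
Proof.
move=> u0; rewrite lt_def dotp_ge0 andbT; apply: contra u0 => /eqP uu0.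
apply/eqP/rowP => i; rewrite mxE; apply/eqP; rewrite -sqrf_eq0 expr2.
move/eqP: uu0; rewrite psumr_eq0 => [/allP/(_ i)|j _].
  by rewrite mem_index_enum => /(_ isT).
by rewrite -expr2 sqr_ge0.
Qed.

Lemma dotp_row_mx {R : realType} {n m : nat} (u1 v1 : 'rV[R]_n)
    (u2 v2 : 'rV[R]_m) :
  dotp (row_mx u1 u2) (row_mx v1 v2) = dotp u1 v1 + dotp u2 v2.
Proof. by rewrite !dotpE tr_row_mx mul_row_col mxE. Qed.

Lemma dotp_mxapp {R : realType} {n s : nat} (l : 'rV[R]_n) (A : 'M[R]_(n, s))
    (v : 'rV[R]_s) :
  dotp l (mxapp A v) = dotp (l *m A) v.
Proof. by rewrite /mxapp !dotpE trmxK mulmxA. Qed.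

(** The factor [n] appears because the norm of ['rV_n] is the supremum norm. *)
Lemma norm_dotp_le {R : realType} {n : nat} (u v : 'rV[R]_n) :
  `|dotp u v| <= n%:R * `|u| * `|v|.
Proof.
have cle (w : 'rV[R]_n) i : `|w 0 i| <= `|w|.
  rewrite [leRHS]mx_normrE.
  by apply: (le_trans _ (le_bigmax _ _ (0, i))) => //=.
apply: le_trans (ler_norm_sum _ _ _) _.
apply: le_trans (ler_sum _ (G := fun=> `|u| * `|v|) _) _ => [i _|].
  by rewrite normrM ler_pM.
by rewrite sumr_const card_ord -mulrA mulr_natl.
Qed.

Lemma continuous_sumr {R : realType} {T : topologicalType} {n : nat}
    (F : 'I_n -> T -> R) :
  (forall i, continuous (F i)) -> continuous (fun x => \sum_(i < n) F i x).
Proof.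
move=> cF.
have -> : (fun x => \sum_(i < n) F i x) = \sum_(i < n) F i.
  by apply/funext => x; rewrite fct_sumE.
apply: (big_ind (fun h : T -> R => continuous h)) => // [x|h k ch ck x].
  exact: cst_continuous.
by apply: continuousD; [exact: ch|exact: ck].
Qed.

Lemma continuous_dotpl {R : realType} {n : nat} (u : 'rV[R]_n) :
  continuous (dotp u).
Proof.
apply: continuous_sumr => i v.
by apply: continuousM; [exact: cst_continuous|exact: coord_continuous].
Qed.

Lemma continuous_dotp_mulmx {R : realType} {p s : nat} (T : 'M[R]_(p, s)) :
  continuous (fun w : 'rV[R]_p => dotp (w *m T) (w *m T)).
Proof.
apply: continuous_sumr => i v.
have c : continuous (fun w : 'rV[R]_p => (w *m T) 0 i).
  have -> : (fun w : 'rV[R]_p => (w *m T) 0 i) = dotp (col i T)^T.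
    by apply/funext => w; rewrite mxE; apply: eq_bigr => j _; rewrite !mxE mulrC.
  exact: continuous_dotpl.
by apply: continuousM; exact: c.
Qed.

(** * Closed cones and polars *)

Lemma polar_cone {R : realType} {n : nat} (A : set 'rV[R]_n) :
  is_cone (polar A).
Proof.
split=> [a _|t l t0 Al a Aa]; first by rewrite dotp0l.
by rewrite dotpZl mulr_ge0 // Al.
Qed.

Lemma polarD {R : realType} {n : nat} (A : set 'rV[R]_n) (u v : 'rV[R]_n) :
  polar A u -> polar A v -> polar A (u + v).
Proof. by move=> Au Av a Aa; rewrite dotpDl addr_ge0 ?Au ?Av. Qed.

Lemma polar_closed {R : realType} {n : nat} (A : set 'rV[R]_n) :
  closed (polar A).
Proof.
have -> : polar A = \bigcap_(a in A) (dotp a @^-1` [set r | 0 <= r]).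
  by apply/seteqP; split=> l Al a Aa /=; move: (Al a Aa); rewrite /= dotpC.
apply: closed_bigI => a _; apply: closed_comp => [l _|]; last exact: closed_ge.
exact: continuous_dotpl.
Qed.

(** A polar is pointed iff the set spans the space: the lineality space of the
    polar is the orthogonal complement of the set. *)
Lemma pointed_polarP {R : realType} {n : nat} {A : set 'rV[R]_n} :
  pointed (polar A) <->
  (forall l, (forall a, A a -> dotp l a = 0) -> l = 0).
Proof.
split=> [pA l lA|H].
  suff : (polar A `&` oppset (polar A)) l by rewrite pA.
  split=> [a Aa|]; first by rewrite lA.
  by exists (- l); [move=> a Aa; rewrite dotpNl lA ?oppr0|rewrite opprK].
apply/seteqP; split=> [l [lA [k kA kl]]|_ ->].
  apply: H => a Aa; apply/eqP; rewrite eq_le lA // andbT.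
  by rewrite -kl dotpNl oppr_le0 kA.
have [P0 _] := polar_cone A.
by split=> //; exists 0; rewrite ?oppr0.
Qed.

(** A function invariant under positive scaling takes all its values at nonzero
    vectors on the unit sphere, and the trace of a closed cone on the sphere is compact. *)
Lemma cone_min {R : realType} {n : nat} (P : set 'rV[R]_n)
    (phi : 'rV[R]_n -> R) (w1 : 'rV[R]_n) :
  is_cone P -> closed P -> P w1 -> w1 != 0 ->
  (forall w, P w -> w != 0 -> {for w, continuous phi}) ->
  (forall t w, 0 < t -> phi (t *: w) = phi w) ->
  exists2 w0, P w0 /\ w0 != 0 & forall w, P w -> w != 0 -> phi w0 <= phi w.
Proof.
move=> [_ Pt] Pcl Pw1 w1N0 cphi hphi.
pose S := P `&` [set w | `|w| = 1].
have Sn w : P w -> w != 0 -> S (`|w|^-1 *: w).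
  move=> Pw w0; split; first by apply: Pt; rewrite ?invr_ge0.
  by rewrite /= normrZ normfV normr_id mulVf ?normr_eq0.
have SN0 w : S w -> w != 0 by move=> [_ /= w1E]; rewrite -normr_eq0 w1E oner_eq0.
have Scpt : compact S.
  apply: bounded_closed_compact.
    by exists 1; split=> // x x1 w [_ /= ->]; exact: ltW.
  apply: closedI => //.
  apply: (@closed_comp _ _ (fun w : 'rV[R]_n => `|w|) [set r : R | r = 1]).
    by move=> w _; exact: norm_continuous.
  exact: closed_eq.
have Scont : {within S, continuous phi}.
  apply: continuous_in_subspaceT => w; rewrite inE => Sw.
  by apply: cphi; [case: Sw|exact: SN0].
have [w0 Sw0 min0] := EVT_min_rV (ex_intro _ _ (Sn _ Pw1 w1N0)) Scpt Scont.
rewrite inE in Sw0; exists w0; first by split; [case: Sw0|exact: SN0].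
move=> w Pw wN0; rewrite -(hphi `|w|^-1 w) ?invr_gt0 ?normr_gt0 //.
by apply: min0; rewrite inE; exact: Sn.
Qed.

(** An interior point [v] can be moved a little in the direction [- l] without
    leaving the polar, which costs a positive multiple of [l . l]. *)
Lemma interior_polar_gt0 {R : realType} {n : nat} (P : set 'rV[R]_n)
    (v l : 'rV[R]_n) :
  interior (polar P) v -> P l -> l != 0 -> 0 < dotp l v.
Proof.
move=> /nbhs_ballP[e /= e0 eP] Pl lN0.
have lpos : 0 < `|l| by rewrite normr_gt0.
(* the step [t *: l] has length [e / 2] *)
pose t := e / 2 / `|l|.
have t0 : 0 < t by rewrite !divr_gt0.
have /eP /(_ l Pl) : ball v e (v - t *: l).
  rewrite -ball_normE /= opprB addrC subrK normrZ gtr0_norm //.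
  by rewrite divfK ?gt_eqF // ltr_pdivrMr // ltr_pMr // ltr1n.
rewrite dotpDl dotpNl dotpZl subr_ge0 dotpC; apply: lt_le_trans.
by rewrite mulr_gt0 // dotp_gt0.
Qed.

(** For the converse, compactness gives [d > 0] with [l . v >= d |l|] on [P], so
    the inequalities survive a perturbation of [v] smaller than [d / (n + 1)];
    the [n] is the constant of [norm_dotp_le]. *)
Lemma interior_polarP {R : realType} {n : nat} {P : set 'rV[R]_n}
    (v : 'rV[R]_n) :
  is_cone P -> closed P ->
  interior (polar P) v <-> (forall l, P l -> l != 0 -> 0 < dotp l v).
Proof.
move=> Pcone Pcl; split=> [vP l|vP]; first exact: interior_polar_gt0.
have [[w1 [Pw1 w1N0]]|P0] := pselect (exists w, P w /\ w != 0); last first.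
  suff -> : polar P = setT by rewrite interiorT.
  apply/seteqP; split=> // u _ l Pl; rewrite (_ : l = 0) ?dotp0r //.
  by apply: contrapT => /eqP lN0; apply: P0; exists l.
have [| |w0 [Pw0 w0N0] min0] :=
  cone_min P (fun w => dotp v w / `|w|) w1 Pcone Pcl Pw1 w1N0.
- move=> w Pw wN0; apply: continuousM; first exact: continuous_dotpl.
  by apply: continuousV; rewrite ?normr_eq0 //; exact: norm_continuous.
- move=> t w t0; rewrite dotpZr normrZ gtr0_norm // invfM mulrACA divff ?mul1r //.
  by rewrite gt_eqF.
set d := dotp v w0 / `|w0| in min0.
have d0 : 0 < d by rewrite divr_gt0 ?normr_gt0 // dotpC vP.
apply/nbhs_ballP; exists (d / n.+1%:R) => /=; first by rewrite divr_gt0.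
move=> u; rewrite -ball_normE /= => uv l Pl.
have [->|lN0] := eqVneq l 0; first by rewrite dotp0r.
have lpos : 0 < `|l| by rewrite normr_gt0.
have := min0 _ Pl lN0; rewrite ler_pdivlMr // => dl.
rewrite -[u](subKr v) dotpDl dotpNl subr_ge0.
apply: le_trans dl; apply: le_trans (ler_norm _) _.
apply: le_trans (norm_dotp_le _ _) _.
rewrite ler_pM2r // mulrC.
move: uv; rewrite ltr_pdivlMr // => /ltW; apply: le_trans.
by rewrite ler_wpM2l // ler_nat.
Qed.

(** * A strict theorem of the alternative for pointed polars *)

(** By pointedness [A] spans the space, so it contains a finite spanning family;
    its sum serves as [e], since an element of the polar has nonnegative products
    with all members, and they vanish if their sum does. The family is given by
    the rows of a matrix of maximal rank among those with rows in [A]. *)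
Lemma pointed_polar_gt0 {R : realType} {p : nat} (A : set 'rV[R]_p) :
  pointed (polar A) ->
  exists e : 'rV[R]_p, forall w, polar A w -> w != 0 -> 0 < dotp w e.
Proof.
move=> /pointed_polarP pA.
pose Q r := `[< exists k (B : 'M[R]_(k, p)),
                 (forall i, A (row i B)) /\ \rank B = r >].
have Q0 : exists r, Q r.
  exists 0%N; apply/asboolP; exists 0%N, 0; split=> [[] //|].
  by rewrite mxrank0.
have Qp r : Q r -> (r <= p)%N.
  by move=> /asboolP[k [B [_ <-]]]; exact: rank_leq_col.
case: (ex_maxnP Q0 Qp) => r /asboolP[k [B [AB rB]]] rmax.
(* otherwise appending [a] as a row would increase the rank *)
have AsubB a : A a -> (a <= B)%MS.
  move=> Aa; have BaB : (B <= col_mx B a)%MS by rewrite -addsmxE addsmxSl.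
  have : (\rank (col_mx B a) <= r)%N.
    apply: rmax; apply/asboolP; exists (k + 1)%N, (col_mx B a); split=> // i.
    rewrite -[i]splitK; case: (fintype.split i) => j /=.
      by rewrite rowKu.
    by rewrite rowKd ord1 row_id.
  rewrite -rB => rle; have := mxrank_leqif_sup BaB.
  rewrite /leqif eqn_leq rle => -[-> /=] /esym.
  by rewrite -addsmxE addsmx_sub submx_refl.
exists (\sum_i row i B) => w Aw wN0.
have dotp_sum : dotp w (\sum_i row i B) = \sum_i dotp w (row i B).
  apply: (big_ind2 (fun x y => dotp w x = y)) => //; first exact: dotp0r.
  by move=> x1 y1 x2 y2 <- <-; rewrite dotpDr.
rewrite lt_def dotp_sum sumr_ge0 ?andbT => [|i _]; last exact: Aw.
apply: contra wN0 => /eqP/psumr_eq0P wB0; apply/eqP/pA => a /AsubB/submxP[D ->].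
have wB : B *m w^T = 0.
  apply/row_matrixP => i; rewrite row_mul row0; apply/rowP => j.
  by rewrite !ord1 -dotpE dotpC wB0 ?mxE // => k' _; exact: Aw.
by rewrite dotpC dotpE -mulmxA wB mulmx0 mxE.
Qed.

(** The first-order condition at the minimizer: with [a = |w0 T|^2],
    [b = w0 . e], [c = w . e], [d = (w T) . (w0 T)] and [q = |w T|^2], the right
    side is the quotient at [w0 + t w]. Comparing the terms of order [t] gives
    [a c <= b d], whence the sign of [d]. *)
Lemma quotient_min_slope_gt0 {R : realFieldType} (a b c d q : R) :
  0 < a -> 0 < b -> 0 < c -> 0 <= q ->
  (forall t, 0 < t ->
     a / b ^+ 2 <= (a + 2 * t * d + t ^+ 2 * q) / (b + t * c) ^+ 2) ->
  0 < d.
Proof.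
move=> a0 b0 c0 q0 ineq; rewrite ltNge; apply/negP => d0.
have q1 : 0 < q + 1 by rewrite ltr_wpDl.
(* If [d <= 0], clearing denominators leaves [2 a b c <= t b^2 q]; this value of
   [t] makes the right side at most [a b c]. *)
have [t t0 tE] : exists2 t, 0 < t & t * (b * (q + 1)) = a * c.
  have bq0 : 0 < b * (q + 1) by rewrite mulr_gt0.
  exists (a * c / (b * (q + 1))); last by rewrite divfK // gt_eqF.
  by rewrite divr_gt0 // mulr_gt0.
have btc : 0 < b + t * c by rewrite addr_gt0 // mulr_gt0.
have := ineq t t0; rewrite ler_pdivrMr ?exprn_gt0 //.
rewrite mulrAC ler_pdivlMr ?exprn_gt0 //.
have -> : a * (b + t * c) ^+ 2 =
  a * b ^+ 2 + 2 * (t * (a * b * c)) + t ^+ 2 * (a * c ^+ 2) by ring.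
have -> : (a + 2 * t * d + t ^+ 2 * q) * b ^+ 2 =
  a * b ^+ 2 + 2 * (t * b ^+ 2 * d) + t * b * (t * (b * (q + 1)))
  - t ^+ 2 * b ^+ 2 by ring.
rewrite tE (_ : t * b * (a * c) = t * (a * b * c)); last by ring.
have tabc : 0 < t * (a * b * c) by rewrite !mulr_gt0.
have tbd : t * b ^+ 2 * d <= 0.
  by apply: mulr_ge0_le0 => //; apply: mulr_ge0 (ltW t0) (sqr_ge0 _).
have tac : 0 <= t ^+ 2 * (a * c ^+ 2).
  by apply: mulr_ge0 (sqr_ge0 _) _; apply: mulr_ge0 (ltW a0) (sqr_ge0 _).
have tb : 0 <= t ^+ 2 * b ^+ 2 by apply: mulr_ge0 (sqr_ge0 _) (sqr_ge0 _).
move: tabc tbd tac tb; clear.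
move: (t * (a * b * c)) (t * b ^+ 2 * d) (t ^+ 2 * (a * c ^+ 2)) => u v w.
move: (t ^+ 2 * b ^+ 2) (a * b ^+ 2) => y z; lra.
Qed.

(** At a minimizer [w0] of [|w T|^2 / (w . e)^2] the quotient cannot decrease
    towards any other [w] of the cone, and the first-order form of this
    gives [(w T) . (w0 T) > 0]. Pointedness cannot be dropped: an injective [T] maps a
    line to a line, which lies in no open half-space. *)
Lemma pointed_polar_alternative {R : realType} {p s : nat} (A : set 'rV[R]_p)
    (T : 'M[R]_(p, s)) :
  pointed (polar A) ->
  (forall w, polar A w -> w *m T = 0 -> w = 0) ->
  exists eta : 'rV[R]_s,
    forall w, polar A w -> w != 0 -> 0 < dotp (w *m T) eta.
Proof.
move=> pA kerT; have [e eP] := pointed_polar_gt0 A pA.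
have [[w1 [Aw1 w1N0]]|A0] := pselect (exists w, polar A w /\ w != 0); last first.
  by exists 0 => w Aw wN0; exfalso; apply: A0; exists w.
pose phi w := dotp (w *m T) (w *m T) / dotp e w ^+ 2.
have [| |w0 [Aw0 w0N0] min0] :=
  cone_min (polar A) phi w1 (polar_cone A) (polar_closed A) Aw1 w1N0.
- move=> w Aw wN0; apply: continuousM; first exact: continuous_dotp_mulmx.
  apply: continuousV; first by rewrite expf_neq0 // gt_eqF // dotpC eP.
  by apply: continuousM; exact: continuous_dotpl.
- move=> t w t0; rewrite /phi -scalemxAl dotpZl !dotpZr exprMn mulrA -expr2.
  by rewrite -mulf_div divff ?mul1r // gt_eqF // exprn_gt0.
have [_ At] := polar_cone A.
exists (w0 *m T) => w Aw wN0.
have b0 := eP _ Aw0 w0N0; have c0 := eP _ Aw wN0.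
have a0 : 0 < dotp (w0 *m T) (w0 *m T).
  by apply: dotp_gt0; apply: contra w0N0 => /eqP/(kerT _ Aw0) ->.
have q0 := dotp_ge0 (w *m T).
have ineq t : 0 < t -> phi w0 <= phi (w0 + t *: w).
  move=> t0; have Aw0t : polar A (w0 + t *: w).
    by apply: polarD => //; apply: At => //; exact: ltW.
  apply: min0 => //; apply/eqP => w0t.
  suff : 0 < dotp (w0 + t *: w) e by rewrite w0t dotp0l ltxx.
  by rewrite dotpDl dotpZl addr_gt0 // mulr_gt0.
apply: (quotient_min_slope_gt0 _ _ _ _ _ a0 b0 c0 q0) => t t0.
have := ineq t t0; rewrite /phi !(dotpC e) !dotpDl !dotpZl mulmxDl -scalemxAl.
rewrite !dotpDl !dotpDr !dotpZl !dotpZr (dotpC (w0 *m T) (w *m T)).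
by congr (_ <= _ / _); ring.
Qed.

(** * Multipliers and directions at a feasible point *)

(** Adjoining [g x] to [K] imposes [mu . g(x) >= 0]; the opposite inequality holds
    for all [mu] in [K*] since [- g x] lies in [K]. *)
Lemma polar_Mstar {R : realType} {s m : nat} (g : 'rV[R]_s -> 'rV[R]_m)
    (K : set 'rV[R]_m) (x : 'rV[R]_s) :
  oppset K (g x) -> Mstar g K x = polar (K `|` [set g x]).
Proof.
move=> [k Kk gk]; apply/seteqP; split=> mu.
  by move=> [Kmu mug] a [Ka|->]; [exact: Kmu|rewrite mug].
move=> Kmu; split=> [a Ka|]; first by apply: Kmu; left.
apply/eqP; rewrite eq_le Kmu ?andbT; last by right.
by rewrite -gk dotpNr oppr_le0; apply: Kmu; left.
Qed.

(** A set whose polar is the product of the two polars, inside the space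
    of block vectors: this lets a result on one polar apply to pairs of
    multipliers. *)
Definition block_union {R : realType} {n m : nat} (A : set 'rV[R]_n)
    (B : set 'rV[R]_m) : set 'rV[R]_(n + m) :=
  [set row_mx a 0 | a in A] `|` [set row_mx 0 b | b in B].

Lemma polar_block_union {R : realType} {n m : nat} (A : set 'rV[R]_n)
    (B : set 'rV[R]_m) l u :
  polar (block_union A B) (row_mx l u) <-> polar A l /\ polar B u.
Proof.
split=> [H|[Al Bu] _ [[a Aa <-]|[b Bb <-]]].
- split=> a Ha.
    suff : 0 <= dotp (row_mx l u) (row_mx a 0).
      by rewrite dotp_row_mx dotp0r addr0.
    by apply: H; left; exists a.
  suff : 0 <= dotp (row_mx l u) (row_mx 0 a) by rewrite dotp_row_mx dotp0r add0r.
  by apply: H; right; exists a.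
- by rewrite dotp_row_mx dotp0r addr0 Al.
- by rewrite dotp_row_mx dotp0r add0r Bu.
Qed.

Lemma pointed_polar_block_union {R : realType} {n m : nat} (A : set 'rV[R]_n)
    (B : set 'rV[R]_m) :
  pointed (polar A) -> pointed (polar B) -> pointed (polar (block_union A B)).
Proof.
move=> /pointed_polarP pA /pointed_polarP pB; apply/pointed_polarP => w.
rewrite -(hsubmxK w) => H.
have -> : lsubmx w = 0.
  apply: pA => a Aa; have := H (row_mx a 0); rewrite dotp_row_mx dotp0r addr0.
  by apply; left; exists a.
have -> : rsubmx w = 0.
  apply: pB => b Bb; have := H (row_mx 0 b); rewrite dotp_row_mx dotp0r add0r.
  by apply; right; exists b.
exact: row_mx0.
Qed.

Lemma pointed_polarS {R : realType} {n : nat} (A B : set 'rV[R]_n) :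
  A `<=` B -> pointed (polar A) -> pointed (polar B).
Proof.
move=> AB /pointed_polarP pA; apply/pointed_polarP => l lB.
by apply: pA => a /AB; exact: lB.
Qed.

Lemma oppsetN {R : realType} {n : nat} (A : set 'rV[R]_n) (v : 'rV[R]_n) :
  oppset A v <-> A (- v).
Proof. by split=> [[a Aa <-]|Av]; [rewrite opprK|exists (- v); rewrite ?opprK]. Qed.

(** The alternative is applied to the stacked Jacobian and the product cone
    [C* x M*(x)]; changing the sign of the vector that it yields turns ascent
    into descent. *)
Lemma not_FJ_criticalP {R : realType} {s n m : nat} (X : set 'rV[R]_s)
    (f : 'rV[R]_s -> 'rV[R]_n) (g : 'rV[R]_s -> 'rV[R]_m)
    (C : set 'rV[R]_n) (K : set 'rV[R]_m) (x : 'rV[R]_s) :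
  pointed (polar C) -> pointed (polar K) -> feasible X g K x ->
  ~ FJ_critical X f g C K x <->
  exists eta : 'rV[R]_s,
    oppset (interior (polar (polar C))) (mxapp (Jac f x) eta) /\
    oppset (interior (polar (Mstar g K x))) (mxapp (Jac g x) eta).
Proof.
move=> pC pK Fx; have gx := Fx.2.
have pM : pointed (polar (K `|` [set g x])).
  by apply: (pointed_polarS _ _ _ pK) => a; left.
split=> [nFJ|[eta [/oppsetN Heta /oppsetN Hmu]] [_ [l [u [Cl Ku lu0 luJ ug]]]]].
  (* a kernel vector of the stacked Jacobian is a pair of critical multipliers *)
  pose A := block_union C (K `|` [set g x]).
  have pA : pointed (polar A) by exact: pointed_polar_block_union.
  have [w|eta etaP] :=
    pointed_polar_alternative A (col_mx (Jac f x) (Jac g x)) pA.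
    rewrite -(hsubmxK w) mul_row_col => /polar_block_union[].
    set l := lsubmx w; set u := rsubmx w.
    rewrite -polar_Mstar // => Cl [Ku ug] luJ.
    apply: contrapT => lu0; apply: nFJ; split=> //; exists l, u; split=> //.
    by move=> [l0 u0]; apply: lu0; rewrite l0 u0 row_mx0.
  exists (- eta); split; apply/oppsetN.
  - apply/(interior_polarP _ (polar_cone _) (polar_closed _)) => l Cl lN0.
    have := etaP (row_mx l 0); rewrite mul_row_col mul0mx addr0.
    rewrite dotpNr dotp_mxapp dotpNr opprK; apply=> //.
      by apply/polar_block_union; split=> // a _; rewrite dotp0l.
    by rewrite row_mx_eq0 (negbTE lN0).
  - rewrite polar_Mstar //.
    apply/(interior_polarP _ (polar_cone _) (polar_closed _)) => u Ku uN0.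
    have := etaP (row_mx 0 u); rewrite mul_row_col mul0mx add0r.
    rewrite dotpNr dotp_mxapp dotpNr opprK; apply=> //.
      by apply/polar_block_union; split=> // a _; rewrite dotp0l.
    by rewrite row_mx_eq0 (negbTE uN0) andbF.
have := congr1 (fun v => dotp v eta) luJ; rewrite dotpDl dotp0l -!dotp_mxapp.
have neg k (P : set 'rV[R]_k) v a : interior (polar P) (- v) -> P a ->
    dotp a v <= 0 /\ (a != 0 -> dotp a v < 0).
  move=> vP Pa; have H : a != 0 -> dotp a v < 0.
    by move=> a0; rewrite -oppr_gt0 -dotpNr (interior_polar_gt0 _ _ _ vP).
  by split=> //; have [->|/H/ltW //] := eqVneq a 0; rewrite dotp0l.
have [l_le l_lt] := neg _ _ _ _ Heta Cl.
have [u_le u_lt] := neg _ _ _ _ Hmu (conj Ku ug).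
have [l0|/l_lt lt0] := eqVneq l 0; last first.
  by move=> eq0; have := ltr_leD lt0 u_le; rewrite eq0 addr0 ltxx.
have [u0|/u_lt lt0] := eqVneq u 0; last first.
  by move=> eq0; have := ler_ltD l_le lt0; rewrite eq0 addr0 ltxx.
by case: lu0; rewrite l0 u0.
Qed.

Theorem theorem4 (R : realType) (s n m : nat)
  (X : set 'rV[R]_s) (C : set 'rV[R]_n) (K : set 'rV[R]_m)
  (f : 'rV[R]_s -> 'rV[R]_n) (g : 'rV[R]_s -> 'rV[R]_m)
  (Xopen : open X)
  (Ccone : is_cone C) (Cclosed : closed C) (Cconvex : convex_set C)
  (Kcone : is_cone K) (Kclosed : closed K) (Kconvex : convex_set K)
  (Cpolar_pointed : pointed (polar C)) (Kpolar_pointed : pointed (polar K))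
  (fdiff : forall x, X x -> differentiable f x)
  (gdiff : forall x, X x -> differentiable g x) :
  FJ_pseudoinvex X f g C K <->
  (forall x, FJ_critical X f g C K x -> weak_global_minimizer X f g C K x).
Proof.
split=> [inv x FJx|min x y Xx Xy].
  have Fx := FJx.1; split=> // -[y [[Xy gy] xy]].
  have [eta /(_ xy Fx.2 gy) etaP] := inv x y Fx.1 Xy.
  by apply/(not_FJ_criticalP X f g C K x): FJx => //; exists eta.
have [[xy [gx gy]]|nH] := pselect
    (strictly_better f C x y /\ oppset K (g x) /\ oppset K (g y)); last first.
  by exists 0 => xy gx gy; case: nH.
have [|eta etaP] := (not_FJ_criticalP X f g C K x
  Cpolar_pointed Kpolar_pointed (conj Xx gx)).1.
  by move=> /min[_]; apply; exists y.
by exists eta.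
Qed.
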